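(* The map $\clubsuit:\mathcal{K}_0^n\to\mathcal{F}^n$ is convex: for every $K,T\in\mathcal{K}_0^n$ and $0\le\lambda\le1$, $$\left((1-\lambda)K+\lambda T\right)^{\clubsuit}\subseteq(1-\lambda)K^{\clubsuit}+\lambda T^{\clubsuit}.$$ The map $\Phi$ is convex when applied to arbitrary star bodies: for all star bodies $A,B\subseteq\mathbb{R}^n$ and $0\le\lambda\le1$, $$\Phi\left((1-\lambda)A+\lambda B\right)\subseteq(1-\lambda)\Phi(A)+\lambda\Phi(B).$$
   Context: A convex body in $\mathbb{R}^n$ is a closed convex set $K\subseteq\mathbb{R}^n$ with $0\in K$ (not assumed compact, nor with non-empty interior); $\mathcal{K}_0^n$ is the set of all convex bodies. The support function of $K$ is $h_K:S^{n-1}\to[0,\infty]$, $h_K(\theta)=\sup_{x\in K}\langle x,\theta\rangle$. A star set is a non-empty $A\subseteq\mathbb{R}^n$ such that $x\in A$ and $0\le\lambda\le1$ imply $\lambda x\in A$; its radial function is $r_A:S^{n-1}\to[0,\infty]$, $r_A(\theta)=\sup\{\lambda\ge0:\lambda\theta\in A\}$. A star body is a star set $A$ with $r_A(\theta)\theta\in A$ for all $\theta\in S^{n-1}$ with $r_A(\theta)<\infty$; it is uniquely determined by $r_A$. For $K\in\mathcal{K}_0^n$, the flower $K^{\clubsuit}$ is the star body with radial function $r_{K^{\clubsuit}}=h_K$. A star body $A\subseteq\mathbb{R}^n$ is a flower if it is a union $\bigcup_{x\in C}B\left(\frac{x}{2},\frac{|x|}{2}\right)$ of closed balls with center $\frac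 x2$ and radius $\frac{|x|}2$ over some closed set $C\subseteq\mathbb{R}^n$; $\mathcal{F}^n$ is the class of flowers in $\mathbb{R}^n$. For a star body $A$, $\Phi(A)$ is the star body with radial function $r_{\Phi(A)}=1/r_A$ ($1/0=\infty$, $1/\infty=0$). $+$ is Minkowski addition (for convex bodies, $K+T=\overline{\{x+y:x\in K,\ y\in T\}}$) and $\lambda A=\{\lambda x:x\in A\}$. *)

(* Defs.v *)
(* R^n is 'rV[R]_n with R : realType, for every n including n = 0.            *)
From mathcomp Require Import all_boot all_order all_algebra.
From mathcomp Require Import all_classical all_reals all_analysis.
From mathcomp Require Import ring lra.
Set Implicit Arguments.
Unset Strict Implicit.
Unset Printing Implicit Defensive.
Import Order.TTheory GRing.Theory Num.Theory.
Import numFieldNormedType.Exports.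
Local Open Scope classical_set_scope.
Local Open Scope ring_scope.

Section defs.
Context {R : realType} {n : nat}.
Implicit Types (A B K : set 'rV[R]_n) (x y theta : 'rV[R]_n) (r : 'rV[R]_n -> \bar R).

(* The library norm on 'rV[R]_n is the sup norm, so the Euclidean structure   *)
(* is introduced here; the topology (closed, closure) is the same.            *)
Definition dotr x y : R := \sum_(i < n) x 0 i * y 0 i.

Definition unit_sphere : set 'rV[R]_n := [set theta | dotr theta theta = 1].

Definition minkowski_sum A B : set 'rV[R]_n :=
  [set x + y | x in A & y in B].

Definition dilate (a : R) A : set 'rV[R]_n := [set a *: x | x in A].

Definition convex_body K : Prop := [/\ closed K, convex_set K & K 0].

Definition convex_body_sum A B : set 'rV[R]_n := closure (minkowski_sum A B).

(* support, radial and the r below are functions on the unit sphere: their    *)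
(* values elsewhere are never used.                                           *)
Definition support K theta : \bar R := ereal_sup [set (dotr x theta)%:E | x in K].

Definition star_set A : Prop :=
  A !=set0 /\ forall x (l : R), A x -> 0 <= l <= 1 -> A (l *: x).

Definition radial A theta : \bar R :=
  ereal_sup [set l%:E | l in [set l : R | 0 <= l /\ A (l *: theta)]].

Definition star_body A : Prop :=
  star_set A /\
  forall theta, unit_sphere theta ->
    (radial A theta < +oo)%E -> A (fine (radial A theta) *: theta).

(* The star body with radial function r >= 0; the origin is listed separately *)
(* only because the sphere is empty when n = 0.                               *)
Definition star_of r : set 'rV[R]_n :=
  [set x | x = 0 \/ exists theta (t : R),
     [/\ unit_sphere theta, 0 <= t, (t%:E <= r theta)%E & x = t *: theta]].

Definition flower_of K : set 'rV[R]_n := star_of (support K).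

(* x^-1 on \bar R satisfies 0^-1 = +oo and +oo^-1 = 0.                        *)
Definition Phi A : set 'rV[R]_n := star_of (fun theta => (radial A theta)^-1%E).

Lemma dotrZ (a b : R) x y : dotr (a *: x) (b *: y) = a * b * dotr x y.
Proof.
rewrite /dotr big_distrr /=; apply: eq_bigr => i _.
by rewrite !mxE mulrACA.
Qed.

Lemma dotrr_eq0 x : dotr x x = 0 -> x = 0.
Proof.
move=> x0; apply/rowP => i; rewrite mxE; apply/eqP.
rewrite -sqrf_eq0 expr2.
move/eqP: x0; rewrite psumr_eq0; last by move=> j _; rewrite -expr2 sqr_ge0.
by move=> /allP /(_ i); rewrite mem_index_enum => /(_ isT).
Qed.

Lemma unit_sphereN0 theta : unit_sphere theta -> theta <> 0.
Proof.
move=> + t0; rewrite t0 /unit_sphere /= /dotr big1.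
  by move/eqP; rewrite eq_sym oner_eq0.
by move=> i _; rewrite mxE mul0r.
Qed.

Lemma polar x : x = 0 \/ exists theta (t : R), [/\ unit_sphere theta, 0 < t & x = t *: theta].
Proof.
have [->|/eqP x0] := eqVneq x 0; first by left.
have d0 : 0 < dotr x x.
  rewrite lt_neqAle eq_sym; apply/andP; split.
    by apply/eqP => /dotrr_eq0.
  by apply: sumr_ge0 => i _; rewrite -expr2 sqr_ge0.
have s0 : 0 < Num.sqrt (dotr x x) by rewrite sqrtr_gt0.
right; exists ((Num.sqrt (dotr x x))^-1 *: x), (Num.sqrt (dotr x x)); split => //.
  rewrite /unit_sphere /= dotrZ -invfM -expr2 sqr_sqrtr ?mulVf ?gt_eqF//.
  exact: ltW.
by rewrite scalerA mulfV ?scale1r// gt_eqF.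
Qed.

Lemma polar_uniq theta theta' (t t' : R) : unit_sphere theta -> unit_sphere theta' ->
  0 <= t -> 0 <= t' -> t *: theta = t' *: theta' -> t = t' /\ (t != 0 -> theta = theta').
Proof.
move=> u u' t0 t0' e.
have tt : t = t'.
  have : dotr (t *: theta) (t *: theta) = dotr (t' *: theta') (t' *: theta') by rewrite e.
  by rewrite !dotrZ u u' !mulr1 -!expr2 => /eqP; rewrite eqrXn2// => /eqP.
split=> // tn0; rewrite tt in tn0 e.
exact: (scalerI tn0 e).
Qed.

Lemma star_ofE r theta (t : R) : (forall th, 0 <= r th)%E ->
  unit_sphere theta -> 0 <= t ->
  star_of r (t *: theta) <-> (t%:E <= r theta)%E.
Proof.
move=> r0 u t0; split; last by move=> tr; right; exists theta, t.
have [->|tn0] := eqVneq t 0; first by move=> _; exact: r0.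
case=> [/eqP|[th [s [us s0 sr e]]]].
  by rewrite scaler_eq0 (negbTE tn0) => /eqP /(unit_sphereN0 u).
have [ts /(_ tn0) ->] := polar_uniq u us t0 s0 e.
by rewrite ts.
Qed.

Lemma radial_star_of r theta : (forall th, 0 <= r th)%E ->
  unit_sphere theta -> radial (star_of r) theta = r theta.
Proof.
move=> r0 u; apply/eqP; rewrite eq_le; apply/andP; split.
  by apply: ge_ereal_sup => _ [l [l0 /(star_ofE r0 u l0) h] <-].
have ub (l : R) : 0 <= l -> (l%:E <= r theta)%E ->
    (l%:E <= radial (star_of r) theta)%E.
  move=> l0 lr; apply: ereal_sup_ubound; exists l => //; split => //.
  exact/star_ofE.
have := r0 theta; case E: (r theta) => [s| |] // s0.
  by apply: ub; rewrite ?E.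
suff -> : radial (star_of r) theta = +oo%E by [].
apply: eq_infty => l; apply: (@le_trans _ _ (Num.max 0 l)%:E).
  by rewrite lee_fin le_max lexx orbT.
by apply: ub; rewrite ?E ?leey// le_max lexx.
Qed.

Lemma star_body_star_of r : (forall th, 0 <= r th)%E -> star_body (star_of r).
Proof.
move=> r0; split; first split; first by exists 0; left.
- move=> x l [->|[th [t [u t0 tr ->]]]] /andP[l0 l1].
    by left; rewrite scaler0.
  rewrite scalerA; apply/(star_ofE r0 u); first exact: mulr_ge0.
  by apply: le_trans tr; rewrite lee_fin ler_piMl.
- move=> th u; rewrite radial_star_of// => rlt.
  apply/(star_ofE r0 u); first exact: fine_ge0.
  by rewrite fineK// ge0_fin_numE.
Qed.

Lemma star_set0 A : star_set A -> A 0.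
Proof. by case=> -[x Ax] /(_ x 0 Ax); rewrite scale0r lexx ler01; exact. Qed.

Lemma radial_ge0 A theta : star_set A -> (0 <= radial A theta)%E.
Proof.
move=> sA; apply: ereal_sup_ubound; exists 0 => //; split => //.
by rewrite scale0r; exact: star_set0.
Qed.

Lemma support_ge0 K theta : K 0 -> (0 <= support K theta)%E.
Proof.
move=> K0; apply: ereal_sup_ubound; exists 0 => //.
by rewrite /dotr big1// => i _; rewrite mxE mul0r.
Qed.

Lemma star_of_radial A : star_body A -> star_of (radial A) = A.
Proof.
move=> [sA bA]; have A0 := star_set0 sA.
apply/seteqP; split => x; last first.
  have [->|[th [t [u t0 ->]]]] := polar x; first by left.
  move=> Ax; right; exists th, t; split => //; first exact: ltW.
  by apply: ereal_sup_ubound; exists t => //; split => //; exact: ltW.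
case=> [->//|[th [t [u t0 tr ->]]]].
have down (s : R) : t <= s -> A (s *: th) -> A (t *: th).
  move=> ts As; have [t00|tn0] := eqVneq t 0; first by rewrite t00 scale0r.
  have s0 : 0 < s by rewrite (lt_le_trans _ ts)// lt_neqAle eq_sym tn0.
  have -> : t *: th = (t / s) *: (s *: th) by rewrite scalerA divfK ?gt_eqF.
  apply: (sA.2 _ _ As); rewrite divr_ge0 ?(ltW s0)//=.
  by rewrite ler_pdivrMr// mul1r.
case E: (radial A th) => [s| |].
- have := bA _ u; rewrite E ltry => /(_ isT); apply: down.
  by rewrite -lee_fin -E.
- have : (t%:E < radial A th)%E by rewrite E ltry.
  by move=> /ereal_sup_gt[_ [s [s0 As] <-]]; rewrite lte_fin => /ltW/down; exact.
- by move: tr; rewrite E.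
Qed.

Lemma star_body_flower_of K : K 0 -> star_body (flower_of K).
Proof. by move=> K0; apply: star_body_star_of => th; exact: support_ge0. Qed.

Lemma radial_flower_of K theta : K 0 -> unit_sphere theta ->
  radial (flower_of K) theta = support K theta.
Proof. by move=> K0; apply: radial_star_of => th; exact: support_ge0. Qed.

Lemma star_body_Phi A : star_set A -> star_body (Phi A).
Proof.
by move=> sA; apply: star_body_star_of => th; rewrite inve_ge0 radial_ge0.
Qed.

Lemma radial_Phi A theta : star_set A -> unit_sphere theta ->
  radial (Phi A) theta = (radial A theta)^-1%E.
Proof.
by move=> sA; apply: radial_star_of => th; rewrite inve_ge0 radial_ge0.
Qed.

(* Phi above is also applied to sums of star bodies: these are star sets but  *)
(* may fail to contain the endpoint of a bounded radial segment.              *)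
Lemma star_set_minkowski_sum A B (a b : R) : star_set A -> star_set B ->
  star_set (minkowski_sum (dilate a A) (dilate b B)).
Proof.
move=> sA sB; split.
  exists (a *: 0 + b *: 0); exists (a *: 0); first by exists 0 => //; exact: star_set0.
  by exists (b *: 0) => //; exists 0 => //; exact: star_set0.
move=> _ l [_ [x Ax <-]] [_ [y By <-] <-] l01.
exists (a *: (l *: x)); first by exists (l *: x) => //; exact: sA.2.
exists (b *: (l *: y)); first by exists (l *: y) => //; exact: sB.2.
by rewrite scalerDr !scalerA ![l * _]mulrC.
Qed.

(* flower_of K and the union of the closed balls with diameter [0, x], x in   *)
(* K, have the same radial function.  As sets they differ when K is unbounded *)
(* and some finite support K theta is not attained: the union is then not a   *)
(* star body, and it only misses the points support K theta *: theta.         *)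
Definition diam_ball x : set 'rV[R]_n :=
  [set y | dotr (y - 2^-1 *: x) (y - 2^-1 *: x) <= dotr (2^-1 *: x) (2^-1 *: x)].

Lemma diam_ballE x y : diam_ball x y <-> dotr y y <= dotr x y.
Proof.
have e : dotr (y - 2^-1 *: x) (y - 2^-1 *: x) =
    dotr y y - dotr x y + dotr (2^-1 *: x) (2^-1 *: x) :> R.
  rewrite /dotr -sumrB -big_split /=; apply: eq_bigr => i _.
  by rewrite !mxE; field.
by rewrite /diam_ball /= e gerDr subr_le0.
Qed.

Lemma radial_bigcup_diam_ball K theta : K 0 -> unit_sphere theta ->
  radial (\bigcup_(x in K) diam_ball x) theta = support K theta.
Proof.
move=> K0 u.
have dZ x (l : R) : diam_ball x (l *: theta) <-> l * l <= l * dotr x theta.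
  rewrite diam_ballE dotrZ u mulr1; have := dotrZ 1 l x theta.
  by rewrite scale1r mul1r => ->.
apply/eqP; rewrite eq_le; apply/andP; split; apply: ge_ereal_sup.
- move=> _ [l [l0 [x Kx /dZ lx]] <-].
  have [->|ln0] := eqVneq l 0; first exact: support_ge0.
  apply: (@le_trans _ _ (dotr x theta)%:E).
    by move: lx; rewrite lee_fin ler_pM2l// lt_neqAle eq_sym ln0.
  by apply: ereal_sup_ubound; exists x.
- move=> _ [x Kx <-]; apply: (@le_trans _ _ (Num.max 0 (dotr x theta))%:E).
    by rewrite lee_fin le_max lexx orbT.
  apply: ereal_sup_ubound; exists (Num.max 0 (dotr x theta)) => //.
  split; first by rewrite le_max lexx.
  have [d0|d0] := leP (dotr x theta) 0.
    by exists 0 => //; apply/dZ; rewrite !mul0r.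
  by exists x => //; apply/dZ.
Qed.

End defs.

(* Main.v *)
Require Import Defs.
From mathcomp Require Import all_boot all_order all_algebra.
From mathcomp Require Import all_classical all_reals all_analysis.
From mathcomp Require Import ring.
Import Order.TTheory GRing.Theory Num.Theory.
Import numFieldNormedType.Exports.
Local Open Scope classical_set_scope.
Local Open Scope ring_scope.

(** Both inclusions follow from one comparison: along a fixed ray Minkowski
    addition is at least as large as addition of radial functions.  Indeed if
    [t] is at most [a r(theta) + b s(theta)], then [t] can be cut as
    [a u + b v] with [u] at most [r(theta)] and [v] at most [s(theta)]
    ([le_comb_split]), so [t theta] is the sum of [a (u theta)] and
    [b (v theta)], two points on the same ray ([star_of_comb]).

    For the flowers, the support function of [(1 - l) K + l T] is at most
    [(1 - l) h_K + l h_T] ([support_comb]), and the flower is the star body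
    whose radial function is the support function; the comparison concludes.

    For [Phi], the comparison shows that the radial function of
    [(1 - l) A + l B] is at least [(1 - l) r_A + l r_B] ([radial_comb]).
    Inversion reverses the order on [[0, +oo]] and is convex there
    ([inve_convex]), so the radial function of the left-hand side is at most
    [(1 - l) / r_A + l / r_B]; the comparison concludes again. *)

Section ereal_comb.
Set Implicit Arguments.
Unset Strict Implicit.
Context {R : realType}.
Implicit Types (a b l t : R) (p q x y : \bar R).

Lemma le_scale_split a t p : 0 <= a -> 0 <= t -> (0 <= p)%E ->
  (t%:E <= a%:E * p)%E ->
  exists u : R, [/\ 0 <= u, (u%:E <= p)%E & t = a * u].
Proof.
move=> a0 t0 p0; have [->|an0] := eqVneq a 0.
  rewrite mul0e lee_fin => tle0; exists 0; split => //.
  by apply/eqP; rewrite mulr0 eq_le tle0.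
have ap : 0 < a by rewrite lt_neqAle eq_sym an0.
move=> tap; exists (a^-1 * t); split.
- by rewrite mulr_ge0// invr_ge0.
- by rewrite EFinM lee_pdivrMl.
- by rewrite mulVKf.
Qed.

(** The two summands are filled greedily: [a p] is exhausted before [b q] is
    used, so the second part is needed only when [a p] is finite. *)
Lemma le_comb_split a b t p q : 0 <= a -> 0 <= b -> 0 <= t ->
  (0 <= p)%E -> (0 <= q)%E -> (t%:E <= a%:E * p + b%:E * q)%E ->
  exists u v : R, [/\ 0 <= u, 0 <= v, (u%:E <= p)%E, (v%:E <= q)%E &
    t = a * u + b * v].
Proof.
move=> a0 b0 t0 p0 q0 tpq.
have [tap|apt] := leP t%:E (a%:E * p)%E.
  have [u [u0 up ->]] := le_scale_split a0 t0 p0 tap.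
  by exists u, 0; split => //; rewrite mulr0 addr0.
have ap0 : (0 <= a%:E * p)%E by rewrite mule_ge0.
case E : (a%:E * p)%E ap0 apt tpq => [c| |] //.
rewrite lee_fin lte_fin => c0 ct tpq.
have cap : (c%:E <= a%:E * p)%E by rewrite E.
have [u [u0 up cu]] := le_scale_split a0 c0 p0 cap.
have tc0 : 0 <= t - c by rewrite subr_ge0 ltW.
have tcq : ((t - c)%:E <= b%:E * q)%E by rewrite EFinB leeBlDl.
have [v [v0 vq tcv]] := le_scale_split b0 tc0 q0 tcq.
by exists u, v; split => //; rewrite -cu -tcv addrC subrK.
Qed.

Lemma comb_ge0 a b p q : 0 <= a -> 0 <= b -> (0 <= p)%E -> (0 <= q)%E ->
  (0 <= a%:E * p + b%:E * q)%E.
Proof. by move=> a0 b0 p0 q0; rewrite adde_ge0// mule_ge0. Qed.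

(** Membership in a star body speaks of finite radii [t] only; this compares
    possibly infinite radial functions through them. *)
Lemma le_ereal_nonneg p q : (0 <= q)%E ->
  (forall t, 0 <= t -> (t%:E <= p)%E -> (t%:E <= q)%E) -> (p <= q)%E.
Proof.
move=> q0 pq; case: p pq => [c| |] pq.
- have [c0|c0] := leP 0 c; first exact: pq.
  by apply: le_trans q0; rewrite lee_fin ltW.
- suff -> : q = +oo%E by [].
  apply: eq_infty => t; apply: (@le_trans _ _ (Num.max 0 t)%:E).
    by rewrite lee_fin le_max lexx orbT.
  by apply: pq; rewrite ?leey// le_max lexx.
- exact: leNye.
Qed.

(** For [0 < l < 1] the inequality is infinite on the right when [x] or [y]
    vanishes and zero on the left when one of them is infinite; at the ends
    [l = 0] and [l = 1] it is an equality because [0 * +oo = 0]. *)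
Lemma inve_convex l x y : 0 <= l <= 1 -> (0 <= x)%E -> (0 <= y)%E ->
  (((1 - l)%:E * x + l%:E * y)^-1 <= (1 - l)%:E * x^-1 + l%:E * y^-1)%E.
Proof.
move=> /andP[l0 l1] x0 y0.
have [->|ln0] := eqVneq l 0; first by rewrite subr0 !mul1e !mul0e !adde0.
have [->|ln1] := eqVneq l 1; first by rewrite subrr !mul1e !mul0e !add0e.
have lp : 0 < l by rewrite lt_neqAle eq_sym ln0.
have lq : 0 < 1 - l by rewrite subr_gt0 lt_neqAle ln1.
have Vx0 : (0 <= x^-1)%E by rewrite inve_ge0.
have Vy0 : (0 <= y^-1)%E by rewrite inve_ge0.
have nNy p : (0 <= p)%E -> p != -oo%E by case: p.
have [->|xn0] := eqVneq x 0%E.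
  by rewrite inve0 gt0_muley ?lte_fin// addye ?leey// nNy// mule_ge0// ltW.
have [->|yn0] := eqVneq y 0%E.
  by rewrite inve0 gt0_muley ?lte_fin// addey ?leey// nNy// mule_ge0// ltW.
have rhs0 := comb_ge0 (ltW lq) (ltW lp) Vx0 Vy0.
have [xoo|xfin] := eqVneq x +oo%E.
  rewrite {1}xoo gt0_muley ?lte_fin// addye ?invey//.
  by rewrite nNy// mule_ge0// ltW.
have [yoo|yfin] := eqVneq y +oo%E.
  rewrite {1}yoo gt0_muley ?lte_fin// addey ?invey//.
  by rewrite nNy// mule_ge0// ltW.
case: x x0 xn0 xfin {Vx0 rhs0} => [x| |] // x0 xn0 _.
case: y y0 yn0 yfin {Vy0} => [y| |] // y0 yn0 _.
have xp : 0 < x by rewrite -lte_fin lt_neqAle eq_sym xn0.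
have yp : 0 < y by rewrite -lte_fin lt_neqAle eq_sym yn0.
have cp : 0 < (1 - l) * x + l * y by rewrite addr_gt0// mulr_gt0.
rewrite -!EFinM -EFinD !inver !gt_eqF// -!EFinM -EFinD lee_fin.
rewrite -subr_ge0.
have -> : (1 - l) / x + l / y - ((1 - l) * x + l * y)^-1 =
    l * (1 - l) * (x - y) ^+ 2 / (x * y * ((1 - l) * x + l * y)).
  by field; rewrite !gt_eqF.
apply: divr_ge0; last by rewrite ltW// !mulr_gt0.
by rewrite mulr_ge0 ?sqr_ge0// mulr_ge0// ltW.
Qed.

End ereal_comb.

(* [support] also abbreviates the nonvanishing locus of a function. *)
Local Notation support := Defs.support.

Section radial_addition.
Set Implicit Arguments.
Unset Strict Implicit.
Context {R : realType} {n : nat}.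
Implicit Types (A B K T : set 'rV[R]_n) (theta x : 'rV[R]_n) (a b : R).

Lemma star_of_le (r s : 'rV[R]_n -> \bar R) :
  (forall theta, unit_sphere theta -> (r theta <= s theta)%E) ->
  star_of r `<=` star_of s.
Proof.
move=> rs x [->|[th [t [u t0 tr ->]]]]; [by left|right; exists th, t].
by split => //; exact: le_trans (rs _ u).
Qed.

(** Radial addition is contained in Minkowski addition.  Points with radius
    exactly [r theta] must be covered too, so the splitting is exact rather
    than up to an approximation. *)
Lemma star_of_comb (r s : 'rV[R]_n -> \bar R) a b : 0 <= a -> 0 <= b ->
  (forall theta, 0 <= r theta)%E -> (forall theta, 0 <= s theta)%E ->
  star_of (fun theta => a%:E * r theta + b%:E * s theta)%E `<=`
  minkowski_sum (dilate a (star_of r)) (dilate b (star_of s)).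
Proof.
move=> a0 b0 r0 s0 x [->|[th [t [u t0 trs ->]]]].
  exists 0; first by exists 0; [left|rewrite scaler0].
  by exists 0; [exists 0; [left|rewrite scaler0]|rewrite addr0].
have [v [w [v0 w0 vr ws ->]]] := le_comb_split a0 b0 t0 (r0 th) (s0 th) trs.
exists (a *: (v *: th)); first by exists (v *: th) => //; apply/star_ofE.
exists (b *: (w *: th)); first by exists (w *: th) => //; apply/star_ofE.
by rewrite scalerDl !scalerA.
Qed.

(** Applying the inclusion of radial sums in Minkowski sums to [A] and [B],
    recovered from their radial functions, puts [t theta] in the sum for every
    [t] up to the left-hand side. *)
Lemma radial_comb A B a b theta : 0 <= a -> 0 <= b ->
  star_body A -> star_body B -> unit_sphere theta ->
  (a%:E * radial A theta + b%:E * radial B theta <=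
   radial (minkowski_sum (dilate a A) (dilate b B)) theta)%E.
Proof.
move=> a0 b0 sA sB u.
have rA th : (0 <= radial A th)%E by apply: radial_ge0 sA.1.
have rB th : (0 <= radial B th)%E by apply: radial_ge0 sB.1.
apply: le_ereal_nonneg => [|t t0 tAB].
  by apply: radial_ge0; apply: star_set_minkowski_sum; [exact: sA.1|exact: sB.1].
apply: ereal_sup_ubound; exists t => //; split => //.
rewrite -(star_of_radial sA) -(star_of_radial sB).
by apply: (star_of_comb a0 b0 rA rB); right; exists theta, t.
Qed.

Lemma dotrDl x y theta : dotr (x + y) theta = dotr x theta + dotr y theta.
Proof. by rewrite /dotr -big_split; apply: eq_bigr => i _; rewrite mxE mulrDl. Qed.

Lemma dotrZl a x theta : dotr (a *: x) theta = a * dotr x theta.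
Proof. by rewrite -[theta in LHS]scale1r dotrZ mulr1. Qed.

Lemma continuous_dotr theta : continuous (fun x => dotr x theta).
Proof.
rewrite /dotr; apply: continuous_big; first exact: add_continuous.
move=> i _ x; apply: continuousM; last exact: cst_continuous.
exact: (@coord_continuous R 1 n 0 i).
Qed.

Lemma support_closure K theta :
  (support (closure K) theta <= support K theta)%E.
Proof.
apply: ge_ereal_sup => _ [x clx <-].
have Kle y : K y -> ((dotr y theta)%:E <= support K theta)%E.
  by move=> Ky; apply: ereal_sup_ubound; exists y.
case: (support K theta) Kle => [c| |] Kle; last 2 first.
- exact: leey.
- by have [y [/Kle]] := clx setT filterT.
have cl : closed [set y | dotr y theta <= c].
  apply: (@closed_comp _ _ (fun y => dotr y theta) [set z | z <= c]).
    by move=> ? _; exact: continuous_dotr.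
  exact: closed_le.
rewrite lee_fin; apply: cl; apply: closure_subset clx => y /Kle.
by rewrite lee_fin.
Qed.

(** Passing to the closure of the sum leaves the bound intact because
    half-spaces are closed; over the sum itself it is read off termwise. *)
Lemma support_comb K T a b theta : 0 <= a -> 0 <= b ->
  (support (convex_body_sum (dilate a K) (dilate b T)) theta <=
   a%:E * support K theta + b%:E * support T theta)%E.
Proof.
move=> a0 b0; apply: le_trans (support_closure _ _) _.
apply: ge_ereal_sup => _ [_ [_ [x Kx <-] [_ [y Ty <-] <-]] <-].
rewrite dotrDl !dotrZl EFinD !EFinM.
apply: leeD; apply: lee_wpmul2l => //.
  by apply: ereal_sup_ubound; exists x.
by apply: ereal_sup_ubound; exists y.
Qed.

End radial_addition.

Theorem theorem45 (R : realType) (n : nat) :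
  (forall (K T : set 'rV[R]_n) (l : R),
     convex_body K -> convex_body T -> 0 <= l <= 1 ->
     flower_of (convex_body_sum (dilate (1 - l) K) (dilate l T)) `<=`
     minkowski_sum (dilate (1 - l) (flower_of K)) (dilate l (flower_of T)))
  /\
  (forall (A B : set 'rV[R]_n) (l : R),
     star_body A -> star_body B -> 0 <= l <= 1 ->
     Phi (minkowski_sum (dilate (1 - l) A) (dilate l B)) `<=`
     minkowski_sum (dilate (1 - l) (Phi A)) (dilate l (Phi B))).
Proof.
split=> [K T l [_ _ K0] [_ _ T0]|A B l sA sB] l01;
  have /andP[l0 l1] := l01; have l1' : 0 <= 1 - l by rewrite subr_ge0.
- apply: subset_trans (star_of_comb l1' l0 _ _) => [|th|th].
  + by apply: star_of_le => th _; exact: support_comb.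
  + exact: support_ge0.
  + exact: support_ge0.
- have rA th : (0 <= radial A th)%E by apply: radial_ge0 sA.1.
  have rB th : (0 <= radial B th)%E by apply: radial_ge0 sB.1.
  apply: subset_trans (star_of_comb l1' l0 _ _) => [|th|th];
    rewrite ?inve_ge0//.
  apply: star_of_le => th u; apply: le_trans (inve_convex l01 (rA th) (rB th)).
  rewrite lee_pV2 ?inE; first exact: radial_comb.
  + apply: radial_ge0; apply: star_set_minkowski_sum; [exact: sA.1|exact: sB.1].
  + exact: comb_ge0.
Qed.
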